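(* For every integer $m\in\mathbb{Z}$, every positive integer $n$ and every complex number $a$, \[ \sum_{ \pi \in \mathcal{D}(n) } (-1)^{ \#(\pi)-1 } \sum_{j=1}^{s(\pi)} \big(\ell(\pi) - s(\pi) + j \big)^m a^{\ell(\pi) - s(\pi) +j}= \sum_{d | n} d^m a^d, \] where the sum on the right is over the positive divisors $d$ of $n$.
   Context: $\mathcal{D}(n)$ denotes the set of partitions of $n$ into distinct parts. For a partition $\pi$, $s(\pi)$ is its smallest part, $\ell(\pi)$ its largest part, and $\#(\pi)$ its number of parts. *)

(* Defs.v *)
From mathcomp Require Import all_boot all_order all_algebra.
From mathcomp Require Import complex reals.

Set Implicit Arguments.
Unset Strict Implicit.
Unset Printing Implicit Defensive.

(* A partition of n into distinct parts is identified with its set of parts.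
   Every part is at most n, so parts are taken in 'I_n.+1; the value 0 is
   excluded by the first condition. *)
Definition distinct_partitions (n : nat) : {set {set 'I_n.+1}} :=
  [set p : {set 'I_n.+1} | (ord0 \notin p) && (\sum_(i in p) i == n)%N].

(* The default value n of the minimum is harmless: it bounds every part, and
   p is nonempty whenever n > 0 (see the two lemmas below). *)
Definition smallest_part (n : nat) (p : {set 'I_n.+1}) : nat :=
  \big[minn/n]_(i in p) (i : nat).

Definition largest_part (n : nat) (p : {set 'I_n.+1}) : nat :=
  \max_(i in p) (i : nat).

Definition num_parts (n : nat) (p : {set 'I_n.+1}) : nat := #|p|.

Lemma distinct_partition_neq0 (n : nat) (p : {set 'I_n.+1}) :
  0 < n -> p \in distinct_partitions n -> p != set0.
Proof.
move=> n0; rewrite inE => /andP[_ sp]; apply/eqP => p0; move: sp.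
by rewrite p0 big_set0 eq_sym (gtn_eqF n0).
Qed.

Lemma smallest_partP (n : nat) (p : {set 'I_n.+1}) : p != set0 ->
  (exists2 i : 'I_n.+1, i \in p & smallest_part p = i) /\
  (forall i : 'I_n.+1, i \in p -> smallest_part p <= i).
Proof.
case/set0Pn=> i0 i0p; case: (arg_minnP (fun i : 'I_n.+1 => i : nat) i0p).
move=> k kp kmin.
suff -> : smallest_part p = k by split=> //; exists k.
apply/eqP; rewrite eqn_leq /smallest_part; apply/andP; split.
  rewrite -big_filter; set r := filter _ _.
  have : k \in r by rewrite mem_filter mem_index_enum andbT.
  elim: r => // i s IHs; rewrite inE big_cons => /orP[/eqP<-|/IHs ks].
    exact: geq_minl.
  exact: leq_trans (geq_minr _ _) ks.
elim/big_ind: _ => [|x y kx ky|i /kmin//].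
- by rewrite -ltnS.
- by rewrite leq_min kx.
Qed.

(* Main.v *)
(** The summands d = l - s + j, 1 <= j <= s, are the d with l - s < d <= l, so
    the coefficient of d^m a^d on the left is the signed count of the distinct
    partitions of n whose parts lie in a window of length d ending at l >= d.
    Its generating function is the sum over l >= d of
    X^l (1 - X^(l-1)) ... (1 - X^(l-d+1)).  After multiplication by 1 - X^d
    this sum telescopes to X^d modulo high powers, so it is X^d / (1 - X^d),
    whose n-th coefficient is 1 if d divides n and 0 otherwise. *)
Require Import Defs.
From mathcomp Require Import all_boot all_order all_algebra.
From mathcomp Require Import complex reals zify ring.

Set Implicit Arguments.
Unset Strict Implicit.
Unset Printing Implicit Defensive.

Import GRing.Theory.
Local Open Scope ring_scope.
Local Open Scope complex_scope.

Section WindowProduct.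
Variable R : comNzRingType.
Implicit Types k e i n : nat.

Definition window_prod k e : {poly R} := \prod_(k <= i < k + e) (1 - 'X^i).

Lemma window_prodSr k e :
  window_prod k e.+1 = window_prod k e * (1 - 'X^(k + e)).
Proof. by rewrite /window_prod addnS big_nat_recr ?leq_addr. Qed.

Lemma window_prodSl k e :
  window_prod k e.+1 = (1 - 'X^k) * window_prod k.+1 e.
Proof. by rewrite /window_prod addnS big_ltn ?addSn // ltnS leq_addr. Qed.

(** Telescoping: sliding the window from [j] to [j.+1] trades the factor [1 - 'X^j] for
    [1 - 'X^(j + e.+1)], a change of ['X^j * (1 - 'X^(e.+1))] times the common factors. The window
    starting at 0 contributes nothing, since [1 - 'X^0 = 0]. *)
Lemma sum_window_prod k e :
  (1 - 'X^(e.+1)) * \sum_(j < k) 'X^j * window_prod j.+1 e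
  = window_prod k e.+1.
Proof.
elim: k => [|k IHk].
  by rewrite big_ord0 mulr0 window_prodSl expr0 subrr mul0r.
rewrite big_ord_recr mulrDr IHk window_prodSl window_prodSr.
by rewrite addSnnS exprD; ring.
Qed.

Lemma coef_window_prod k e i : (i < k)%N -> (window_prod k e)`_i = (i == 0%N)%:R.
Proof.
move=> ltik; elim: e => [|e IHe].
  by rewrite /window_prod addn0 big_geq // coef1.
by rewrite window_prodSr mulrBr mulr1 coefB coefMXn IHe ltn_addr // subr0.
Qed.

Lemma coef_sum_window_prod k e i : (i < e.+1 + k)%N ->
  ('X^(e.+1) * \sum_(j < k) 'X^j * window_prod j.+1 e)`_i
  = ((0 < i)%N && (e.+1 %| i)%N)%:R.
Proof.
set G := 'X^(e.+1) * _.
(* Division by [1 - 'X^(e.+1)] becomes a recursion on coefficients with step [e.+1]. The bound on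
   [i] keeps every index read in the window product below [k], where that product looks like 1. *)
have defG : G = 'X^(e.+1) * G + 'X^(e.+1) * window_prod k e.+1.
  by rewrite -sum_window_prod /G; ring.
move: G defG => G defG.
elim/ltn_ind: i => i IHi ltik.
rewrite {1}defG coefD !coefXnM.
case: ltnP => [ltie|leei].
  by rewrite addr0; case: i ltie {IHi ltik} => // i ltie; rewrite gtnNdvd.
rewrite IHi ?coef_window_prod; try lia.
(* The window product contributes only at [i = e.+1], exactly where the recursive term vanishes
   because its index is 0. *)
rewrite (leq_trans _ leei) // subn_eq0.
have [->|nei] := eqVneq i e.+1; first by rewrite subnn dvdnn leqnn add0r.
rewrite subn_gt0 ltn_neqAle eq_sym nei leei leqNgt ltn_neqAle eq_sym nei leei.
by rewrite addr0 dvdn_subl.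
Qed.

Lemma prod_one_sub (I : finType) (A : {set I}) (w : I -> nat) :
  \prod_(i in A) (1 - 'X^(w i) : {poly R})
  = \sum_(J : {set I} | J \subset A) (-1) ^+ #|J| * 'X^(\sum_(i in J) w i).
Proof.
rewrite big_mkcond /=.
(* The summand 0 outside [A] kills every term of the expansion indexed by a set not contained in
   [A]. *)
transitivity (\prod_i ((if i \in A then - 'X^(w i) else 0) + 1 : {poly R})).
  by apply: eq_bigr => i _; case: ifP => _; rewrite ?add0r // addrC.
rewrite bigA_distr (bigID (fun J : {set I} => J \subset A)) /=.
rewrite [X in _ + X]big1 ?addr0 => [|J /subsetPn[i iJ iA]].
  apply: eq_bigr => J /subsetP JA.
  rewrite -big_mkcond /= -prodrXr -prodrN; apply: eq_bigr => i /JA ->//.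
by rewrite (bigD1 i) //= iJ (negPf iA) mul0r.
Qed.

End WindowProduct.

Lemma largest_partP (n : nat) (p : {set 'I_n.+1}) : p != set0 ->
  (exists2 i : 'I_n.+1, i \in p & largest_part p = i) /\
  (forall i : 'I_n.+1, i \in p -> (i <= largest_part p)%N).
Proof.
rewrite -card_gt0 => p0; split; last by move=> i ip; exact: leq_bigmax_cond.
by rewrite /largest_part; have [i ip ->] := eq_bigmax_cond (fun i : 'I_n.+1 => i : nat) p0; exists i.
Qed.

Lemma parts_in_windowP (n e : nat) (p : {set 'I_n.+1}) (l : 'I_n.+1) :
  p != set0 ->
  reflect (l \in p /\ forall i, i \in p -> (i <= l < i + e)%N)
          ((largest_part p == l) && (l < smallest_part p + e)%N).
Proof.
move=> p0; apply: (iffP andP); have [[k kp ks] smin] := smallest_partP p0;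
  have [[t tp tl] lmax] := largest_partP p0.
- case=> /eqP lpl ls.
  have etl : t = l by apply/val_inj; rewrite /= -tl lpl.
  by split=> [|i ip]; [rewrite -etl|have := smin i ip; have := lmax i ip; lia].
- by case=> lp Hl; have := Hl k kp; have := Hl t tp; have := lmax l lp; lia.
Qed.

Section SignedCount.
Variables (R : comNzRingType) (n : nat).

(** Removing the largest part [l] leaves an arbitrary subset [J] of the [e] integers just below [l],
    and the sign becomes [(-1) ^+ #|J|]; expanding the product enumerates these subsets. *)
Lemma signed_count_largest (e : nat) (l : 'I_n.+1) : (e < l)%N ->
  \sum_(p in distinct_partitions n |
          (largest_part p == l) && (l < smallest_part p + e.+1)%N)
     (-1) ^+ (num_parts p).-1
  = ('X^l * window_prod R (l - e) e)`_n.
Proof.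
move=> ltel.
pose A := [set i : 'I_n.+1 | (i < l) && (l - e <= i)]%N.
have -> : window_prod R (l - e) e = \prod_(i in A) (1 - 'X^i).
  rewrite /window_prod subnK 1?ltnW // (@big_nat_widen _ _ _ _ _ n.+1) 1?ltnW //.
  by rewrite big_geq_mkord; apply: eq_bigl => i; rewrite inE.
rewrite (prod_one_sub R A (fun i : 'I_n.+1 => i : nat)) mulr_sumr coef_sum.
have n0 : (0 < n)%N by case: l ltel {A} => l /=; lia.
rewrite (reindex_onto (fun J : {set 'I_n.+1} => l |: J) (fun p => p :\ l)); last first.
  move=> p /andP[/(distinct_partition_neq0 n0) p0 /(parts_in_windowP _ _ p0)[lp _]].
  by rewrite setD1K.
have notlA (J : {set 'I_n.+1}) : J \subset A -> l \notin J.
  by move=> /subsetP JA; apply/negP=> /JA; rewrite inE ltnn.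
have condE (J : {set 'I_n.+1}) : [&& l |: J \in distinct_partitions n,
    (largest_part (l |: J) == l) && (l < smallest_part (l |: J) + e.+1)%N
    & (l |: J) :\ l == J] = (J \subset A) && (\sum_(i in l |: J) i == n)%N.
  have p0 : l |: J != set0 by apply/set0Pn; exists l; rewrite setU11.
  apply/and3P/andP => [[Dp /(parts_in_windowP _ _ p0)[_ Hl] /eqP eJ]|[JA sJ]].
    move: Dp; rewrite inE => /andP[_ ->]; split=> //.
    apply/subsetP => i iJ; have := Hl i (setU1r _ iJ).
    have : i != l by move: iJ; rewrite -eJ !inE => /andP[].
    rewrite inE -val_eqE /=; lia.
  have Hl i : i \in l |: J -> (i <= l < i + e.+1)%N.
    case/setU1P => [->|/(subsetP JA)]; [lia|rewrite inE; lia].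
  split; last by rewrite setU1K ?notlA.
    (* A part 0 would force [l < e.+1], against [e < l]. *)
    rewrite inE sJ andbT; apply/negP => /Hl /=; lia.
  by apply/(parts_in_windowP _ _ p0); split; [exact: setU11|].
under eq_bigl do rewrite -andbA condE.
rewrite big_mkcondr; apply: eq_bigr => J /notlA lJ.
rewrite big_setU1 //= /num_parts cardsU1 lJ /= mulrCA -exprD.
rewrite -[X in X ^+ #|J| * _](rmorphN1 (@polyC R)) -rmorphXn coefCM coefXn eq_sym.
by case: eqP; rewrite ?mulr1 ?mulr0.
Qed.

Lemma signed_count_window (d : nat) : (0 < d <= n)%N ->
  \sum_(p in distinct_partitions n |
          ((largest_part p < smallest_part p + d) && (d <= largest_part p))%N)
     (-1) ^+ (num_parts p).-1
  = (d %| n)%N%:R :> R.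
Proof.
case: d => // e /= len; have n0 : (0 < n)%N by lia.
rewrite (partition_big (fun p : {set 'I_n.+1} => inord (largest_part p) : 'I_n.+1)
          (fun l : 'I_n.+1 => e < l)%N) /=; last first.
  move=> p /andP[/(distinct_partition_neq0 n0)/largest_partP[[i _ ->] _]].
  by rewrite inord_val => /andP[].
transitivity (\sum_(l < n.+1 | (e < l)%N) ('X^l * window_prod R (l - e) e)`_n).
  apply: eq_bigr => l ltel; rewrite -signed_count_largest //.
  apply: eq_bigl => p; rewrite -andbA; apply: andb_id2l => Dp.
  have [[i _ ->] _] := largest_partP (distinct_partition_neq0 n0 Dp).
  rewrite inord_val -val_eqE /=; case: eqP => [->|]; rewrite ?ltel ?andbF ?andbT//.
transitivity (\sum_(0 + e.+1 <= l < n.+1) ('X^l * window_prod R (l - e) e)`_n).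
  by rewrite big_geq_mkord.
rewrite big_addn big_mkord.
have := @coef_sum_window_prod R (n.+1 - e.+1) e n; rewrite n0 => <-; last lia.
(* With [l = k + e.+1] the window below [l] starts at [l - e = k.+1]. *)
rewrite mulr_sumr coef_sum; apply: eq_bigr => k _.
by rewrite mulrA -exprD [(e.+1 + k)%N]addnC addnS -addSn addnK.
Qed.

(** Substitutes [d] for the shifted index. The range of [d] is made independent of [p], with the
    dependence moved into the filter, so that the sums over [p] and [d] can be exchanged. *)
Lemma sum_window_shift (f : nat -> R) (p : {set 'I_n.+1}) : (0 < n)%N ->
  p \in distinct_partitions n ->
  \sum_(1 <= j < (smallest_part p).+1) f (largest_part p - smallest_part p + j)%N
  = \sum_(1 <= d < n.+1 | (largest_part p < smallest_part p + d)%N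
                         && (d <= largest_part p)%N) f d.
Proof.
move=> n0 /(distinct_partition_neq0 n0) p0.
have [[k kp ks] _] := smallest_partP p0.
have [[t _ tl] lmax] := largest_partP p0.
have lesl : (smallest_part p <= largest_part p)%N by rewrite ks lmax.
have leln : (largest_part p <= n)%N by rewrite tl -ltnS.
set l := largest_part p in lesl leln *; set s := smallest_part p in lesl *.
transitivity (\sum_(1 + (l - s) <= d < l.+1) f d).
  rewrite big_addn (_ : (l.+1 - (l - s))%N = s.+1); last lia.
  by apply: eq_bigr => j _; rewrite addnC.
rewrite (@big_nat_widen _ _ _ _ _ n.+1) // (@big_nat_widenl _ _ _ _ 1%N) //.
apply: eq_bigl => d /=; lia.
Qed.

Lemma big_divisors (f : nat -> R) : (0 < n)%N ->
  \sum_(d <- divisors n) f d = \sum_(1 <= d < n.+1 | (d %| n)%N) f d.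
Proof.
move=> n0; rewrite -[RHS]big_filter; apply/perm_big/uniq_perm.
- exact: divisors_uniq.
- exact/filter_uniq/iota_uniq.
move=> d; rewrite mem_filter mem_index_iota -dvdn_divisors //.
apply/idP/andP => [dn|[]//]; split=> //.
by rewrite (dvdn_gt0 n0 dn) ltnS dvdn_leq.
Qed.

(** The identity holds for arbitrary weights [f d], because it holds coefficient by coefficient:
    after the exchange of sums, [f d] is multiplied by the signed count, which is 1 or 0 according
    to divisibility. *)
Lemma signed_sum_distinct_partitions (f : nat -> R) : (0 < n)%N ->
  \sum_(p in distinct_partitions n)
     (-1) ^+ (num_parts p).-1 *
     (\sum_(1 <= j < (smallest_part p).+1)
         f (largest_part p - smallest_part p + j)%N)
  = \sum_(d <- divisors n) f d.
Proof.
move=> n0; rewrite big_divisors // [RHS]big_mkcond /=.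
transitivity (\sum_(p in distinct_partitions n) \sum_(1 <= d < n.+1)
  if ((largest_part p < smallest_part p + d) && (d <= largest_part p))%N
  then (-1) ^+ (num_parts p).-1 * f d else 0).
  by apply: eq_bigr => p Dp; rewrite sum_window_shift // -big_mkcond mulr_sumr.
rewrite exchange_big /=; apply: eq_big_nat => d dn.
by rewrite -big_mkcondr -mulr_suml signed_count_window // mulrC mulr_natr mulrb.
Qed.

End SignedCount.

Theorem theorem2p4 (R : realType) (m : int) (n : nat) (n_gt0 : (0 < n)%N)
    (a : R[i]) :
  \sum_(p in distinct_partitions n)
     (-1) ^+ (num_parts p).-1 *
     (\sum_(1 <= j < (smallest_part p).+1)
         ((largest_part p - smallest_part p + j)%N%:R : R[i]) ^ m *
         a ^+ (largest_part p - smallest_part p + j)%N)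
  = \sum_(d <- divisors n) (d%:R : R[i]) ^ m * a ^+ d.
Proof.
exact: (@signed_sum_distinct_partitions _ n (fun d => (d%:R : R[i]) ^ m * a ^+ d)).
Qed.
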